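(* Let $n\geq4$, $\lambda\in\Bbbk$. Let $M$ be an $\mathcal{H}(\mathcal{Q}_n^{\chi}[\lambda])$-module such that, as $\mathbb{S}_n$-module, $M=M[\epsilon]\oplus M[\operatorname{sgn}]$, with $\dim M[\epsilon]=p$, $\dim M[\operatorname{sgn}]=q$, $p,q\geq0$ (finite). Then $M$ is indecomposable if and only if it is simple, if and only if $M\cong S_\epsilon$ or $M\cong S_{\operatorname{sgn}}$.
   Context: $\Bbbk$ is an algebraically closed field of characteristic zero; $\mathbb{S}_n$ is the symmetric group, $\mathcal{O}_2^n$ its conjugacy class of transpositions; $\epsilon$ and $\operatorname{sgn}$ are the trivial and sign characters. For $\sigma\in\mathbb{S}_n$ and $\tau=(ij)\in\mathcal{O}_2^n$ with $i<j$, put $\chi(\sigma,\tau)=1$ if $\sigma(i)<\sigma(j)$ and $\chi(\sigma,\tau)=-1$ if $\sigma(i)>\sigma(j)$. The Hopf algebra $\mathcal{H}(\mathcal{Q}_n^{\chi}[\lambda])$ is generated as an algebra by $H_t$ ($t\in\mathbb{S}_n$) and $a_\tau$ ($\tau\in\mathcal{O}_2^n$) with relations: $H_e=1$, $H_tH_s=H_{ts}$; $H_ta_\tau=\chi(t,\tau)\,a_{t\tau t^{-1}}H_t$; $a_{(12)}^2=0$; $a_{(12)}a_{(34)}-a_{(34)}a_{(12)}=0$; $a_{(12)}a_{(23)}-a_{(13)}a_{(12)}-a_{(23)}a_{(13)}=\lambda(1-H_{(12)}H_{(23)})$ (the analogous quadratic relations for other transpositions are obtained from these by conjugation with the $H_t$).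 Any such module is an $\mathbb{S}_n$-module via $t\mapsto H_t$, and $M[\rho]$ is its $\rho$-isotypic component. For $\rho\in\{\epsilon,\operatorname{sgn}\}$, $S_\rho$ is the one-dimensional module where $H_t$ acts by $\rho(t)$ and all $a_\tau$ act by $0$. *)

(* Defs.v *)
From HB Require Import structures.
From mathcomp Require Import all_boot all_order all_algebra all_fingroup.
From mathcomp Require Import boolp.
From mathcomp.multinomials Require Import monalg.

Set Implicit Arguments.
Unset Strict Implicit.
Unset Printing Implicit Defensive.

Import GRing.Theory.
Import Quotient.

Local Open Scope ring_scope.
Local Open Scope quotient_scope.

Notation free_alg k G := {malg k[{fmonom G}]}.

Section Presentation.
Variables (k : fieldType) (G : choiceType) (rels : free_alg k G -> Prop).

Definition gen (g : G) : free_alg k G := << fmu g >>.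

Definition two_sided_ideal (I : free_alg k G -> Prop) : Prop :=
  [/\ I 0, forall x y, I x -> I y -> I (x - y)
         & forall a x b, I x -> I (a * x * b)].

Definition in_gen_ideal (x : free_alg k G) : Prop :=
  forall I, two_sided_ideal I -> (forall r, rels r -> I r) -> I x.

Lemma in_gen_ideal_two_sided : two_sided_ideal in_gen_ideal.
Proof.
split=> [I [I0 _ _] _ //|x y Ix Iy I II rI|a x b Ix I II rI].
  by case: (II) => _ IB _; apply: IB; [apply: Ix | apply: Iy].
by case: (II) => _ _ IM; apply: IM; apply: Ix.
Qed.

Lemma rels_in_gen_ideal r : rels r -> in_gen_ideal r.
Proof. by move=> rr I _; apply. Qed.

Definition gen_ideal : {pred free_alg k G} := fun x => `[< in_gen_ideal x >].

Lemma gen_ideal_zmod_closed : zmod_closed gen_ideal.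
Proof.
have [I0 IB _] := in_gen_ideal_two_sided.
split=> [|x y /asboolP Ix /asboolP Iy]; apply/asboolP => //.
exact: IB.
Qed.

HB.instance Definition _ :=
  GRing.isZmodClosed.Build (free_alg k G) gen_ideal gen_ideal_zmod_closed.

Lemma gen_idealM a x b : x \in gen_ideal -> a * x * b \in gen_ideal.
Proof.
have [_ _ IM] := in_gen_ideal_two_sided.
by move=> /asboolP Ix; apply/asboolP; apply: IM.
Qed.

(* The quotient k<G> / (rels). Its multiplication is built here because
   ring_quotient only provides it for commutative rings. *)
Definition pres_alg : Type := {quot gen_ideal}.

HB.instance Definition _ := GRing.Zmodule.on pres_alg.

Definition pres_pi (x : free_alg k G) : pres_alg := \pi_{quot gen_ideal} x.
Definition pres_repr (x : pres_alg) : free_alg k G :=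
  generic_quotient.repr (x : {quot gen_ideal}).

Lemma pres_reprK : cancel pres_repr pres_pi.
Proof. exact: reprK. Qed.

Lemma pres_piP x y : reflect (pres_pi x = pres_pi y) (x - y \in gen_ideal).
Proof. by rewrite (idealrBE gen_ideal); apply: eqP. Qed.

Lemma pres_piD x y : pres_pi (x + y) = pres_pi x + pres_pi y.
Proof. exact: pi_add. Qed.

Definition pres_one : pres_alg := pres_pi 1.
Definition pres_mul (x y : pres_alg) : pres_alg :=
  pres_pi (pres_repr x * pres_repr y).
Definition pres_scale (c : k) (x : pres_alg) : pres_alg :=
  pres_pi (c *: pres_repr x).

Lemma pres_piM x y : pres_pi (x * y) = pres_mul (pres_pi x) (pres_pi y).
Proof.
apply/pres_piP; set x' := pres_repr _; set y' := pres_repr _.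
have Ix : x - x' \in gen_ideal by apply/pres_piP; rewrite pres_reprK.
have Iy : y - y' \in gen_ideal by apply/pres_piP; rewrite pres_reprK.
have -> : x * y - x' * y' = 1 * (x - x') * y + x' * (y - y') * 1.
  by rewrite mul1r mulr1 mulrBl mulrBr addrA subrK.
by rewrite rpredD // gen_idealM.
Qed.

Lemma pres_piZ c x : pres_pi (c *: x) = pres_scale c (pres_pi x).
Proof.
apply/pres_piP; rewrite -scalerBr.
set d := _ - _; have -> : c *: d = (c *: 1) * d * 1.
  by rewrite mulr1 -scalerAl mul1r.
by apply/gen_idealM/pres_piP; rewrite pres_reprK.
Qed.

Let pE := (pres_piD, pres_piM, pres_piZ).
Ltac pres_lift x := rewrite -[x]pres_reprK; move: (pres_repr x) => {}x.

Fact pres_mulA : associative pres_mul.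
Proof.
move=> x y z; pres_lift x; pres_lift y; pres_lift z.
by rewrite -!pE mulrA.
Qed.
Fact pres_mul1l : left_id pres_one pres_mul.
Proof. by move=> x; pres_lift x; rewrite -!pE mul1r. Qed.
Fact pres_mul1r : right_id pres_one pres_mul.
Proof. by move=> x; pres_lift x; rewrite -!pE mulr1. Qed.
Fact pres_mulDl : left_distributive pres_mul +%R.
Proof.
move=> x y z; pres_lift x; pres_lift y; pres_lift z.
by rewrite -!pE mulrDl.
Qed.
Fact pres_mulDr : right_distributive pres_mul +%R.
Proof.
move=> x y z; pres_lift x; pres_lift y; pres_lift z.
by rewrite -!pE mulrDr.
Qed.

HB.instance Definition _ := GRing.Zmodule_isPzRing.Build pres_alg
  pres_mulA pres_mul1l pres_mul1r pres_mulDl pres_mulDr.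

Fact pres_scaleA a b x :
  pres_scale a (pres_scale b x) = pres_scale (a * b) x.
Proof. by pres_lift x; rewrite -!pE scalerA. Qed.
Fact pres_scale1 : left_id 1 pres_scale.
Proof. by move=> x; pres_lift x; rewrite -!pE scale1r. Qed.
Fact pres_scaleDr : right_distributive pres_scale +%R.
Proof. by move=> c x y; pres_lift x; pres_lift y; rewrite -!pE scalerDr. Qed.
Fact pres_scaleDl x : {morph pres_scale^~ x : a b / a + b}.
Proof. by move=> a b; pres_lift x; rewrite -!pE scalerDl. Qed.

HB.instance Definition _ := GRing.Zmodule_isLmodule.Build k pres_alg
  pres_scaleA pres_scale1 pres_scaleDr pres_scaleDl.

Fact pres_scaleAl (c : k) (x y : pres_alg) : c *: (x * y) = (c *: x) * y.
Proof.
rewrite /GRing.scale /GRing.mul /=; pres_lift x; pres_lift y.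
by rewrite -!pE scalerAl.
Qed.

Fact malg_scaleAr (c : k) (x y : free_alg k G) : c *: (x * y) = x * (c *: y).
Proof.
have xC : x * c%:MP = c%:MP * x.
  rewrite !malgM_def fgmulUg fgmulgU; apply: eq_bigr => m _.
  by rewrite mulrC mul1m mulm1.
by rewrite -!mul_malgC mulrA mulrA xC.
Qed.

Fact pres_scaleAr (c : k) (x y : pres_alg) : c *: (x * y) = x * (c *: y).
Proof.
rewrite /GRing.scale /GRing.mul /=; pres_lift x; pres_lift y.
by rewrite -!pE malg_scaleAr.
Qed.

Section Eval.
Variable f : G -> k.

Definition word_eval (m : {fmonom G}) : k := \prod_(g <- m) f g.

Fact word_eval_mmorphism : mmorphism word_eval.
Proof.
split=> [m1 m2|]; rewrite /word_eval ?fm1 ?big_nil //.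
by rewrite fmM big_cat.
Qed.
HB.instance Definition _ :=
  isMultiplicative.Build {fmonom G} k word_eval word_eval_mmorphism.

Definition free_eval (x : free_alg k G) : k := mmap idfun word_eval x.

Lemma free_evalB x y : free_eval (x - y) = free_eval x - free_eval y.
Proof. exact: raddfB. Qed.
Lemma free_evalM x y : free_eval (x * y) = free_eval x * free_eval y.
Proof. exact: rmorphM. Qed.
Lemma free_eval1 : free_eval 1 = 1.
Proof. exact: rmorph1. Qed.
Lemma free_evalZ c x : free_eval (c *: x) = c * free_eval x.
Proof. exact: mmapZ. Qed.
Lemma free_eval_gen g : free_eval (gen g) = f g.
Proof. by rewrite /free_eval /gen mmapU mul1r /word_eval fmU big_seq1. Qed.

(* The algebra map pres_alg -> k induced by f, provided f kills rels. *)
Definition pres_eval (x : pres_alg) : k := free_eval (pres_repr x).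

Hypothesis f_rels : forall r, rels r -> free_eval r = 0.

Lemma pres_eval_pi x : pres_eval (pres_pi x) = free_eval x.
Proof.
apply/eqP; rewrite eq_sym -subr_eq0 -free_evalB; apply/eqP.
have: x - pres_repr (pres_pi x) \in gen_ideal.
  by apply/pres_piP; rewrite pres_reprK.
move=> /asboolP Ix; apply: (Ix (fun y => free_eval y = 0)) => //.
split=> [|u v u0 v0|a u b u0].
- exact: raddf0.
- by rewrite free_evalB u0 v0 subr0.
- by rewrite !free_evalM u0 mulr0 mul0r.
Qed.

Lemma pres_evalD x y : pres_eval (x + y) = pres_eval x + pres_eval y.
Proof.
pres_lift x; pres_lift y.
by rewrite -pres_piD !pres_eval_pi; apply: raddfD.
Qed.
Lemma pres_evalM x y : pres_eval (x * y) = pres_eval x * pres_eval y.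
Proof.
rewrite {1}/GRing.mul /=; pres_lift x; pres_lift y.
by rewrite -pres_piM !pres_eval_pi free_evalM.
Qed.
Lemma pres_eval1 : pres_eval 1 = 1.
Proof. by rewrite [1]/(pres_pi 1) pres_eval_pi free_eval1. Qed.
Lemma pres_evalZ c x : pres_eval (c *: x) = c * pres_eval x.
Proof.
rewrite {1}/GRing.scale /=; pres_lift x.
by rewrite -pres_piZ !pres_eval_pi free_evalZ.
Qed.

End Eval.

End Presentation.

Inductive lin_char := Eps | Sgn.

(* n and lambda only record over which algebra this space is a module. *)
Definition S_mod (k : fieldType) (n : nat) (lambda : k) (rho : lin_char)
  : Type := k.

Section Algebra.
Variables (k : fieldType) (n : nat).

Definition O2 : {set 'S_n} :=
  [set tau | [exists i : 'I_n, exists j : 'I_n, (i != j) && (tau == tperm i j)]].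

Definition transposition : Type := {tau : 'S_n | tau \in O2}.

HB.instance Definition _ := Finite.on transposition.

Lemma O2J (t tau : 'S_n) : tau \in O2 -> (tau ^ t)%g \in O2.
Proof.
rewrite !inE => /existsP[i /existsP[j /andP[ij /eqP->]]].
apply/existsP; exists (t i); apply/existsP; exists (t j).
by rewrite (inj_eq perm_inj) ij tpermJ eqxx.
Qed.

(* The product of 'S_n composes from left to right, whereas the formulas
   H_t H_s = H_(ts) and H_t a_tau = chi(t, tau) a_(t tau t^-1) H_t use the
   composition of functions: there ts is (s * t)%g, and t tau t^-1 is
   (tau ^ t)%g, which maps (i j) to (t(i) t(j)). *)
Definition conj_tr (t : 'S_n) (tau : transposition) : transposition :=
  exist _ (sval tau ^ t)%g (O2J t (svalP tau)).

Definition chi (sigma : 'S_n) (tau : transposition) : k :=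
  if [exists i : 'I_n, exists j : 'I_n,
       [&& (i < j)%N, sval tau == tperm i j & (sigma j < sigma i)%N]]
  then - 1 else 1.

(* tau is the transposition (x y) of {1, ..., n}; an element i : 'I_n stands
   for the letter i.+1. *)
Definition is_tr (x y : nat) (tau : transposition) : bool :=
  [exists i : 'I_n, exists j : 'I_n,
    [&& i.+1 == x, j.+1 == y & sval tau == tperm i j]].

Definition generator : choiceType := ('S_n + transposition)%type.

Definition gH (t : 'S_n) : free_alg k generator := gen k (inl t : generator).
Definition ga (tau : transposition) : free_alg k generator :=
  gen k (inr tau : generator).

Inductive Qrel (lambda : k) : free_alg k generator -> Prop :=
| Qrel_one : Qrel lambda (gH 1%g - 1)
| Qrel_mul t s : Qrel lambda (gH t * gH s - gH (s * t)%g)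
| Qrel_conj t tau :
    Qrel lambda (gH t * ga tau - chi t tau *: (ga (conj_tr t tau) * gH t))
| Qrel_sqr t12 of is_tr 1 2 t12 : Qrel lambda (ga t12 ^+ 2)
| Qrel_comm t12 t34 of is_tr 1 2 t12 & is_tr 3 4 t34 :
    Qrel lambda (ga t12 * ga t34 - ga t34 * ga t12)
| Qrel_quad t12 t23 t13 of is_tr 1 2 t12 & is_tr 2 3 t23 & is_tr 1 3 t13 :
    Qrel lambda (ga t12 * ga t23 - ga t13 * ga t12 - ga t23 * ga t13
                 - lambda *: (1 - gH (sval t12) * gH (sval t23))).

Definition char_val (rho : lin_char) (t : 'S_n) : k :=
  if rho is Sgn then (-1) ^+ odd_perm t else 1.

Definition S_on_gen (rho : lin_char) (g : generator) : k :=
  if g is inl t then char_val rho t else 0.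

Lemma odd_is_tr x y tau : is_tr x y tau -> x != y -> odd_perm (sval tau).
Proof.
move=> /existsP[i /existsP[j /and3P[/eqP<- /eqP<- /eqP->]]].
by rewrite odd_tperm; apply: contra_neq => ->.
Qed.

Lemma S_on_gen_rels lambda rho r :
  Qrel lambda r -> free_eval (S_on_gen rho) r = 0.
Proof.
have e (c : k) x : free_eval (S_on_gen rho) (c *: x)
    = c * free_eval (S_on_gen rho) x by exact: free_evalZ.
case=> [|t s|t tau|t12 _|t12 t34 _ _|t12 t23 t13 h12 h23 _];
  rewrite ?expr2 ?(free_evalB, e, free_evalM, free_eval1, free_eval_gen) /=;
  rewrite ?(mulr0, mul0r, subr0, sub0r, oppr0) //.
- by case: rho {e} => /=; rewrite ?odd_perm1 ?expr0 subrr.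
- case: rho {e} => /=; first by rewrite mulr1 subrr.
  by rewrite odd_permM addbC signr_addb subrr.
- case: rho {e} => /=; first by rewrite mulr1 subrr mulr0 oppr0.
  rewrite (odd_is_tr h12) // (odd_is_tr h23) //.
  by rewrite mulrNN mulr1 subrr mulr0 oppr0.
Qed.

Definition Q_alg (lambda : k) : Type := pres_alg (Qrel lambda).

Section QAlg.
Variable lambda : k.
Local Notation Q := (Q_alg lambda).

HB.instance Definition _ := GRing.PzRing.on Q.
HB.instance Definition _ := GRing.Lmodule.on Q.

Definition S_eval (rho : lin_char) (x : Q) : k := pres_eval (S_on_gen rho) x.

Fact Q_one_neq0 : (1 : Q) != 0.
Proof.
apply/eqP => /(congr1 (S_eval Eps)); apply/eqP.
have ev := @S_on_gen_rels lambda Eps.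
rewrite /S_eval (pres_eval1 ev).
rewrite (_ : pres_eval _ 0 = 0) ?oner_neq0 //.
have := pres_evalD ev 0 0.
by rewrite addr0 => /esym/eqP; rewrite -subr_eq0 addrK => /eqP.
Qed.

HB.instance Definition _ := GRing.PzSemiRing_isNonZero.Build Q Q_one_neq0.
HB.instance Definition _ := GRing.Lmodule_isLalgebra.Build k Q
  (@pres_scaleAl _ _ (Qrel lambda)).
HB.instance Definition _ := GRing.Lalgebra_isAlgebra.Build k Q
  (@pres_scaleAr _ _ (Qrel lambda)).

Definition H_ (t : 'S_n) : Q := pres_pi (Qrel lambda) (gH t).
Definition a_ (tau : transposition) : Q := pres_pi (Qrel lambda) (ga tau).

Section SMod.
Variable rho : lin_char.
Local Notation S := (S_mod n lambda rho).

HB.instance Definition _ := GRing.Zmodule.on S.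

Definition S_act (x : Q) (v : S) : S := S_eval rho x * v.

Let ev := @S_on_gen_rels lambda rho.

Fact S_actA x y v : S_act x (S_act y v) = S_act (x * y) v.
Proof. by rewrite /S_act /S_eval pres_evalM // mulrA. Qed.
Fact S_act1 : left_id 1 S_act.
Proof. by move=> v; rewrite /S_act /S_eval pres_eval1 // mul1r. Qed.
Fact S_actDr : right_distributive S_act +%R.
Proof. by move=> x u v; rewrite /S_act mulrDr. Qed.
Fact S_actDl v : {morph S_act^~ v : x y / x + y}.
Proof. by move=> x y; rewrite /S_act /S_eval pres_evalD // mulrDl. Qed.

HB.instance Definition _ := GRing.Zmodule_isLmodule.Build Q S
  S_actA S_act1 S_actDr S_actDl.

Lemma S_mod_H t (v : S) : H_ t *: v = char_val rho t * v :> k.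
Proof.
rewrite [LHS]/(S_eval rho _ * v) /S_eval /H_ pres_eval_pi //.
by rewrite free_eval_gen.
Qed.

Lemma S_mod_a tau (v : S) : a_ tau *: v = 0.
Proof.
rewrite [LHS]/(S_eval rho _ * v) /S_eval /a_ pres_eval_pi //.
by rewrite free_eval_gen; apply: (@mul0r k).
Qed.

End SMod.

Section Modules.
Variable M : lmodType Q.

(* For the one-dimensional character rho, the simple S_n-submodules of M
   isomorphic to rho are the lines spanned by the nonzero v such that
   H_t v = rho(t) v for all t; their sum is the subspace of all such v. *)
Definition isotypic (rho : lin_char) : {pred M} :=
  [pred m | [forall t, H_ t *: m == (char_val rho t)%:A *: m]].

(* The k-space structure of an H-module is given by c, m |-> c%:A *: m. *)
Definition has_dim (V : {pred M}) (d : nat) : Prop :=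
  exists b : 'I_d -> M,
    (forall i, b i \in V) /\
    (forall m, m \in V ->
       exists! c : {ffun 'I_d -> k}, m = \sum_(i < d) (c i)%:A *: b i).

Definition is_direct_sum (U V : {pred M}) : Prop :=
  (forall m, exists u v, [/\ u \in U, v \in V & m = u + v]) /\
  (forall m, m \in U -> m \in V -> m = 0).

(* Submodules are boolean predicates closed under the module operations; with
   the excluded middle of boolp, every subset of M is such a predicate. *)
Definition simple_mod : Prop :=
  (exists m : M, m != 0) /\
  (forall U : {pred M}, submod_closed U -> U =i pred1 0 \/ U =i predT).

Definition indecomposable : Prop :=
  (exists m : M, m != 0) /\
  (forall U V : {pred M}, submod_closed U -> submod_closed V ->
     is_direct_sum U V -> U =i pred1 0 \/ V =i pred1 0).

End Modules.

Definition lmod_iso (M N : lmodType Q) : Prop :=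
  exists f : {linear M -> N}, bijective f.

End QAlg.
End Algebra.

Arguments transposition n : clear implicits.
Arguments Q_alg k n lambda : clear implicits.
Arguments S_mod {k} n lambda rho.
Arguments H_ {k n lambda} t.
Arguments a_ {k n lambda} tau.
Arguments isotypic {k n lambda} M rho.

(* Main.v *)
Require Import Defs.
From HB Require Import structures.
From mathcomp Require Import all_boot all_algebra all_fingroup.
From mathcomp Require Import boolp.
From mathcomp.multinomials Require Import monalg.

(* Two disjoint transpositions s and t give t a_s = a_s t and s a_s = - a_s s
   in the algebra. On M = M[eps] + M[sgn] all transpositions act by the same
   involution, so a_s acts both commuting and anticommuting with it, hence by 0:
   this is where n >= 4 enters. Every element of the algebra then acts on each
   isotypic component by a scalar, the isotypic components are submodules, and
   all their subspaces too, so an indecomposable M is a line. *)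

Import GRing.Theory.
Local Open Scope ring_scope.

(** * Induction on words in the generators *)

(** Every element is a finite sum of scaled words, and a word arises from [1] by prepending letters,
    so left multiplication by single generators suffices. *)
Lemma free_alg_ind (k : fieldType) (G : choiceType) (P : free_alg k G -> Prop) :
  (forall x y, P x -> P y -> P (x + y)) -> (forall c x, P x -> P (c *: x)) ->
  P 1 -> (forall g x, P x -> P (gen k g * x)) -> forall x, P x.
Proof.
move=> PD PZ P1 PM x; rewrite [x]monalgE; apply: (big_ind P) => // [|w _].
  by rewrite -(scale0r 1); apply: PZ.
have -> : << x@_w *g w >> = x@_w *: << w >> :> free_alg k G.
  by apply/malgP => v; rewrite mcoeffZ !mcoeffU mulrnAr mulr1.
apply: PZ; case: w => s; elim: s => [|g s IHs].
  by rewrite -fmoneE.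
suff -> : << FMonom (g :: s) >> = gen k g * << FMonom s >> :> free_alg k G.
  exact: PM.
rewrite /gen malgM_def fgmulUU mulr1; congr << _ >>.
by apply/eqP; rewrite fmP fmM fmU.
Qed.

Lemma pres_alg_ind (k : fieldType) (G : choiceType) (rels : free_alg k G -> Prop)
    (P : pres_alg rels -> Prop) :
  (forall x y, P x -> P y -> P (x + y)) -> (forall c x, P x -> P (c *: x)) ->
  P 1 -> (forall g x, P x -> P (pres_pi rels (gen k g) * x)) -> forall x, P x.
Proof.
move=> PD PZ P1 PM x; rewrite -[x]pres_reprK.
elim/free_alg_ind: (pres_repr x) => {x} [x y Px Py|c x Px||g x Px].
- by rewrite pres_piD; apply: PD.
- by rewrite pres_piZ; apply: PZ.
- exact: P1.
- by rewrite pres_piM; apply: PM.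
Qed.

Lemma pres_pi_rel (k : fieldType) (G : choiceType) (rels : free_alg k G -> Prop)
    x y : rels (x - y) -> pres_pi rels x = pres_pi rels y.
Proof.
by move=> rxy; apply/(@pres_piP _ _ rels)/asboolP; apply: rels_in_gen_ideal.
Qed.

Arguments pres_pi_rel {k G rels x y}.

Lemma H_a_conj (k : fieldType) (n : nat) (lambda : k) (t : 'S_n) tau :
  H_ t * a_ tau = chi k t tau *: (a_ (conj_tr t tau) * H_ t)
  :> Q_alg k n lambda.
Proof.
have := pres_pi_rel (Qrel_conj lambda t tau); rewrite pres_piM => e.
apply: (etrans e); apply: etrans (pres_piZ _ _ _) _.
exact: (congr1 (pres_scale _) (pres_piM _ _ _)).
Qed.

Lemma H_tpermK (k : fieldType) (n : nat) (lambda : k) (x y : 'I_n) :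
  H_ (tperm x y) * H_ (tperm x y) = 1 :> Q_alg k n lambda.
Proof.
have := pres_pi_rel (Qrel_mul lambda (tperm x y) (tperm x y)).
by rewrite pres_piM tperm2 (pres_pi_rel (Qrel_one n lambda)).
Qed.

Lemma Q_alg_ind (k : fieldType) (n : nat) (lambda : k)
    (P : Q_alg k n lambda -> Prop) :
  (forall x y, P x -> P y -> P (x + y)) -> (forall c x, P x -> P (c *: x)) ->
  P 1 -> (forall t x, P x -> P (H_ t * x)) ->
  (forall tau x, P x -> P (a_ tau * x)) -> forall x, P x.
Proof.
move=> PD PZ P1 PH Pa.
by apply: (@pres_alg_ind k _ (Qrel lambda) P PD PZ P1) => -[t|tau];
  [apply: PH|apply: Pa].
Qed.

(** * The characters of the algebra given by the two one-dimensional modules *)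

Section SEval.
Variables (k : fieldType) (n : nat) (lambda : k) (rho : lin_char).
Implicit Types x y : Q_alg k n lambda.
Let ev := @S_on_gen_rels k n lambda rho.

Lemma S_evalD x y : S_eval rho (x + y) = S_eval rho x + S_eval rho y.
Proof. exact: (pres_evalD ev). Qed.

Lemma S_evalM x y : S_eval rho (x * y) = S_eval rho x * S_eval rho y.
Proof. exact: (pres_evalM ev). Qed.

Lemma S_evalZ c x : S_eval rho (c *: x) = c * S_eval rho x.
Proof. exact: (pres_evalZ ev). Qed.

Lemma S_eval1 : S_eval rho (1 : Q_alg k n lambda) = 1.
Proof. exact: (pres_eval1 ev). Qed.

Lemma S_evalH t : S_eval rho (H_ t : Q_alg k n lambda) = char_val k rho t.
Proof. by rewrite /S_eval pres_eval_pi // free_eval_gen. Qed.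

Lemma S_eval_a tau : S_eval rho (a_ tau : Q_alg k n lambda) = 0.
Proof. by rewrite /S_eval pres_eval_pi // free_eval_gen. Qed.

End SEval.

(** * Modules on which an algebra acts through scalars *)

Section AlgebraActions.
Variables (k : fieldType) (A : algType k) (M : lmodType A).

Lemma act_algM (g x : A) (b c : k) (m : M) :
  g *: m = b%:A *: m -> x *: m = c%:A *: m -> (g * x) *: m = (b * c)%:A *: m.
Proof.
move=> gm xm.
have -> : (b * c)%:A = c%:A * b%:A :> A by rewrite mulr_algl scalerA mulrC.
by rewrite -!scalerA xm -gm !scalerA mulr_algl mulr_algr.
Qed.

Lemma act_algZ (x : A) (b c : k) (m : M) :
  x *: m = c%:A *: m -> (b *: x) *: m = (b * c)%:A *: m.
Proof. by move=> xm; rewrite -[b *: x]mulr_algl; apply: act_algM. Qed.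

Lemma algA_comm (x : A) (c : k) (m : M) : x *: (c%:A *: m) = c%:A *: (x *: m).
Proof. by rewrite !scalerA mulr_algl mulr_algr. Qed.

Lemma algA_lin (a b c : k) (m : M) :
  (a * b + c)%:A *: m = a%:A *: (b%:A *: m) + c%:A *: m.
Proof. by rewrite scalerDl scalerDl scalerA mulr_algl scalerA. Qed.

Lemma act_eigen_lin (x : A) (b c : k) (u v : M) :
  x *: u = b%:A *: u -> x *: v = b%:A *: v ->
  x *: (c%:A *: u + v) = b%:A *: (c%:A *: u + v).
Proof. by move=> xu xv; rewrite !scalerDr algA_comm xu xv algA_comm. Qed.

Lemma act_invK (c : k) (m : M) : c != 0 -> (c^-1)%:A *: (c%:A *: m) = m.
Proof.
by move=> c0; rewrite scalerA mulr_algl [X in X *: m]scalerA mulVf ?scale1r.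
Qed.

Lemma line_inj (m : M) : m != 0 -> injective (fun c : k => c%:A *: m).
Proof.
move=> m0 c d /eqP; rewrite -subr_eq0 -scalerBl -scalerBl => /eqP cdm.
apply/eqP; rewrite -subr_eq0; apply: contraNT m0 => cd0.
by rewrite -(act_invK _ m cd0) cdm scaler0.
Qed.

(** Since [s] and [t] agree on [M], [a t v = t a v = s a v = - a s v = - a t v], hence
    [2 a t v = 0]. As [t] is an involution, every [m] has the form [t v]. *)
Lemma act_anticomm0 (a s t : A) : (2%:R : k) != 0 ->
  (forall m : M, s *: m = t *: m) ->
  t * a = a * t -> s * a = - (a * s) -> t * t = 1 -> forall m : M, a *: m = 0.
Proof.
move=> two_neq0 st ta sa tt m.
have anti (v : M) : a *: (t *: v) = - (a *: (t *: v)).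
  by rewrite -{2}st !scalerA -scaleNr -sa -ta -!scalerA st.
have a2 (v : M) : (a *: (t *: v)) *+ 2 = 0 by rewrite mulr2n {1}anti addNr.
have -> : m = t *: (t *: m) by rewrite scalerA tt scale1r.
by rewrite -[LHS](act_invK _ _ two_neq0) scaler_nat scaler_nat a2 scaler0.
Qed.

(** Makes the coordinate along a spanning vector a module map to a one-dimensional module: both
    sides agree after multiplication by [m0], which is injective on scalars. *)
Lemma line_coord_linear (e : A -> k) (m0 : M) (f : M -> k) :
  m0 != 0 -> (forall x (m : M), x *: m = (e x)%:A *: m) ->
  (forall m, m = (f m)%:A *: m0) ->
  forall x u v, f (x *: u + v) = e x * f u + f v.
Proof.
move=> m0n0 eE fE x u v; apply: (line_inj _ m0n0) => /=.
by rewrite algA_lin -!fE -eE.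
Qed.

Lemma scalar_submod (e : A -> k) (U : {pred M}) :
  (forall x m, m \in U -> x *: m = (e x)%:A *: m) -> 0 \in U ->
  (forall (c : k) u v, u \in U -> v \in U -> c%:A *: u + v \in U) ->
  submod_closed U.
Proof. by move=> eE U0 UP; split=> // x u v Uu Uv; rewrite eE //; apply: UP. Qed.

(* The line of one basis vector and the span of the others are complementary
   submodules. *)
Lemma indecomposable_line (e : A -> k) (d : nat) (b : 'I_d -> M) :
  (forall x (m : M), x *: m = (e x)%:A *: m) ->
  (forall m : M, exists! c : {ffun 'I_d -> k}, m = \sum_(i < d) (c i)%:A *: b i) ->
  (exists m : M, m != 0) ->
  (forall U V : {pred M}, submod_closed U -> submod_closed V ->
    (forall m : M, exists u v, [/\ u \in U, v \in V & m = u + v]) ->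
    (forall m : M, m \in U -> m \in V -> m = 0) ->
    U =i pred1 0 \/ V =i pred1 0) ->
  exists2 m0 : M, m0 != 0 & forall m, exists c : k, m = c%:A *: m0.
Proof.
move=> eE bP [m1 m1_neq0] indec.
pose comb (c : {ffun 'I_d -> k}) := \sum_(i < d) (c i)%:A *: b i.
have comb_inj : injective comb.
  by move=> c c' cc; have [c0 [_ u]] := bP (comb c); rewrite -(u c) // (u c').
have combP (a : k) (c c' : {ffun 'I_d -> k}) :
    comb [ffun i => a * c i + c' i] = a%:A *: comb c + comb c'.
  rewrite /comb scaler_sumr -big_split; apply: eq_bigr => i _ /=.
  by rewrite ffunE algA_lin.
have comb0 : comb [ffun=> 0] = 0.
  by rewrite /comb big1 // => i _; rewrite ffunE !scale0r.
(* An empty basis would make every vector zero, against [m1_neq0]. *)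
have [i0 _] : exists i0 : 'I_d, True.
  case: (posnP d) => [d0|d_gt0]; last by exists (Ordinal d_gt0).
  have [c [cE _]] := bP m1; case/eqP: m1_neq0.
  by rewrite cE big1 // => i; have := ltn_ord i; rewrite {2}d0.
have comb_i0 (c : k) : comb [ffun i => if i == i0 then c else 0] = c%:A *: b i0.
  rewrite /comb (bigD1 i0) //= ffunE eqxx big1 ?addr0 // => i /negPf ii0.
  by rewrite ffunE ii0 !scale0r.
have bi0_neq0 : b i0 != 0.
  apply/eqP => bi0; have /comb_inj/ffunP/(_ i0)/eqP :
      comb [ffun i => if i == i0 then 1 else 0] = comb [ffun=> 0].
    by rewrite comb0 comb_i0 bi0 scaler0.
  by rewrite !ffunE eqxx oner_eq0.
exists (b i0) => //.
pose U : {pred M} := fun m => `[< exists c : k, m = c%:A *: b i0 >].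
pose V : {pred M} := fun m =>
  `[< exists2 c : {ffun 'I_d -> k}, c i0 = 0 & m = comb c >].
have split_at m : exists u v, [/\ u \in U, v \in V & m = u + v].
  have [c [cE _]] := bP m.
  exists ((c i0)%:A *: b i0), (comb [ffun i => if i == i0 then 0 else c i]).
  split; first by apply/asboolP; exists (c i0).
    by apply/asboolP; eexists; last by []; rewrite ffunE eqxx.
  (* Inserting the scalar [1%:A] gives the sum the shape of [combP] with [a = 1]. *)
  rewrite -comb_i0 -[X in X + _]scale1r -(scale1r (1 : A)) -combP cE.
  congr comb.
  by apply/ffunP => i; rewrite !ffunE mul1r; case: eqP => [->|_];
    rewrite ?addr0 ?add0r.
have subU : submod_closed U.
  apply: (scalar_submod e) => // [|c u v /asboolP[c1 ->] /asboolP[c2 ->]].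
    by apply/asboolP; exists 0; rewrite !scale0r.
  apply/asboolP; exists (c * c1 + c2).
  by rewrite algA_lin.
have subV : submod_closed V.
  apply: (scalar_submod e) => // [|c u v /asboolP[c1 z1 ->] /asboolP[c2 z2 ->]].
    by apply/asboolP; exists [ffun=> 0]; rewrite ?ffunE.
  apply/asboolP; exists [ffun i => c * c1 i + c2 i]; last by rewrite combP.
  by rewrite ffunE z1 z2 mulr0 addr0.
have [|U0|V0] := indec U V subU subV split_at.
- move=> _ /asboolP[c ->] /asboolP[c' c'0]; rewrite -comb_i0 => /comb_inj c'E.
  by move: c'0; rewrite -c'E ffunE eqxx => ->; rewrite comb_i0 !scale0r.
- have : b i0 \in U by apply/asboolP; exists 1; rewrite !scale1r.
  by rewrite U0 inE (negPf bi0_neq0).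
- move=> m; have [u [v [/asboolP[c ->]]]] := split_at m.
  by rewrite V0 inE => /eqP-> ->; exists c; rewrite addr0.
Qed.

End AlgebraActions.
Arguments line_inj {k A M m}.
Arguments act_eigen_lin {k A M x b c u v}.
Arguments scalar_submod {k A M}.
Arguments algA_comm {k A M}.
Arguments indecomposable_line {k A M}.
Arguments line_coord_linear {k A M e m0 f}.
Arguments act_algM {k A M g x b c m}.
Arguments act_algZ {k A M x b c m}.
Arguments act_anticomm0 {k A M a s t}.

(** * Vanishing of the generators [a_ tau] on [M] *)

(** Supplies a transposition disjoint from [(i j)]: removing at most two of at least four letters
    leaves at least two. *)
Lemma ord_pair_avoiding (n : nat) (i j : 'I_n) : (4 <= n)%N ->
  exists x y : 'I_n, [/\ x != y, x \notin [set i; j] & y \notin [set i; j]].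
Proof.
move=> n4; set B := ~: [set i; j].
have B1 : (1 < #|B|)%N.
  rewrite -(ltn_add2l #|[set i; j]|) cardsC card_ord.
  by apply: leq_trans n4; rewrite addn1 cards2; case: (_ != _).
have /card_gt1P [x [y [Bx By xy]]] := B1.
by exists x, y; rewrite -!in_setC.
Qed.

(** All transpositions are odd, so each fixes the trivial part [u] and negates the sign part [v]. *)
Lemma H_tperm_eq (k : fieldType) (n : nat) (lambda : k)
    (M : lmodType (Q_alg k n lambda)) (i j x y : 'I_n) (m : M) :
  is_direct_sum (isotypic M Eps) (isotypic M Sgn) -> i != j -> x != y ->
  H_ (tperm i j) *: m = H_ (tperm x y) *: m.
Proof.
move=> [/(_ m)[u [v [/forallP Hu /forallP Hv ->]]] _] ij xy.
have Hs (z w : 'I_n) : z != w -> H_ (tperm z w) *: (u + v)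
    = 1%:A *: u + (-1)%:A *: v.
  move=> zw; rewrite scalerDr (eqP (Hu (tperm z w))) (eqP (Hv (tperm z w))) /=.
  by rewrite odd_tperm zw.
by rewrite !Hs.
Qed.

Lemma a_act0 (k : fieldType) (n : nat) (lambda : k)
    (M : lmodType (Q_alg k n lambda)) (tau : transposition n) (m : M) :
  [pchar k] =i pred0 -> (4 <= n)%N ->
  is_direct_sum (isotypic M Eps) (isotypic M Sgn) -> a_ tau *: m = 0.
Proof.
move=> k0 n4 Mdec.
have [i [j [ij tauE]]] :
    exists i j : 'I_n, (i < j)%N /\ sval tau = tperm i j.
  case: tau => tau /=; rewrite inE => /existsP[i /existsP[j /andP[ij /eqP->]]].
  case: (ltngtP i j) ij => // [lij|lji|/val_inj->]; last by rewrite eqxx.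
    by exists i, j.
  by exists j, i; rewrite tpermC.
have neq_ij : i != j by rewrite neq_ltn ij.
have [x [y [xy xij yij]]] := ord_pair_avoiding n i j n4.
(* Stated for any letter moved by [(i j)], because [chi] may present the same transposition by
   another pair [z], [w]. *)
have fix_tau z : tperm i j z != z -> tperm x y z = z.
  move=> moved; have zij : z \in [set i; j].
    by apply: contraR moved; rewrite !inE negb_or => /andP[zi zj];
      rewrite tpermD // eq_sym.
  by apply: tpermD; [apply: contraNneq xij|apply: contraNneq yij] => ->.
(* The disjoint transposition fixes both letters of [tau], so it cannot reverse their order. *)
have chi_t : chi k (tperm x y) tau = 1.
  rewrite /chi; case: existsP => // -[z /existsP[w /and3P[zw]]].
  rewrite tauE => /eqP e.
  have nzw : z != w by rewrite neq_ltn zw.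
  rewrite !fix_tau ?e ?tpermL ?tpermR //; last by rewrite eq_sym.
  by rewrite ltnNge ltnW.
have conj_t : conj_tr (tperm x y) tau = tau.
  apply: val_inj => /=; rewrite tauE tpermJ !fix_tau ?tpermL ?tpermR //.
  by rewrite eq_sym.
(* [tau] exchanges its own letters [i < j]; this reversal is the source of the anticommutation. *)
have chi_tau : chi k (tperm i j) tau = -1.
  rewrite /chi; case: existsP => // -[]; exists i; apply/existsP; exists j.
  by rewrite tpermL tpermR tauE eqxx ij.
have conj_tau : conj_tr (tperm i j) tau = tau.
  by apply: val_inj => /=; rewrite tauE tpermJ tpermL tpermR tpermC.
apply: (act_anticomm0 (s := H_ (tperm i j)) (t := H_ (tperm x y))).
- by have := k0 2; rewrite !inE /= => /negbT.
- by move=> m'; apply: H_tperm_eq.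
- by rewrite H_a_conj chi_t conj_t scale1r.
- by rewrite H_a_conj chi_tau conj_tau scaleN1r.
- exact: H_tpermK.
Qed.

(** * Isotypic components as submodules, and the classification *)

(** The generators act on [m] by the values of the character [S_eval rho]. Each right factor of a
    word returns a multiple of [m], so vanishing of the [a_ tau] at this one vector is enough for
    the induction. *)
Lemma isotypic_act (k : fieldType) (n : nat) (lambda : k)
    (M : lmodType (Q_alg k n lambda)) rho (m : M) x :
  (forall tau, a_ tau *: m = 0) -> m \in isotypic M rho ->
  x *: m = (S_eval rho x)%:A *: m.
Proof.
move=> am /forallP Hm.
elim/Q_alg_ind: x => [x y IHx IHy|c x IHx||t x IHx|tau x IHx].
- by rewrite S_evalD !scalerDl IHx IHy.
- by rewrite S_evalZ; exact: act_algZ IHx.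
- by rewrite S_eval1 scale1r.
- by rewrite S_evalM S_evalH; exact: act_algM (eqP (Hm t)) IHx.
- rewrite S_evalM S_eval_a.
  by apply: (act_algM _ IHx); rewrite am !scale0r.
Qed.

Lemma sum_pred0l (V : zmodType) (P Q : {pred V}) :
  (forall m, exists u v, [/\ u \in P, v \in Q & m = u + v]) ->
  P =i pred1 0 -> Q =i predT.
Proof.
move=> PQ P0 m; have [u [v [Pu Qv ->]]] := PQ m.
by move: Pu; rewrite P0 inE => /eqP->; rewrite add0r Qv.
Qed.

Lemma sum_pred0r (V : zmodType) (P Q : {pred V}) :
  (forall m, exists u v, [/\ u \in P, v \in Q & m = u + v]) ->
  Q =i pred1 0 -> P =i predT.
Proof.
move=> PQ; apply: sum_pred0l => m; have [u [v [Pu Qv ->]]] := PQ m.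
by exists v, u; rewrite addrC.
Qed.

Lemma simple_indecomposable (k : fieldType) (n : nat) (lambda : k)
    (M : lmodType (Q_alg k n lambda)) : simple_mod M -> indecomposable M.
Proof.
move=> [Mn0 Msim]; split=> // U V subU subV [_ UV0].
case: (Msim U subU) => [|UT]; first by left.
right=> v; rewrite !inE; apply/idP/eqP => [Vv|->]; last by case: subV.
by apply: UV0; rewrite ?UT.
Qed.

Lemma iso_simple (k : fieldType) (n : nat) (lambda : k)
    (M : lmodType (Q_alg k n lambda)) rho :
  lmod_iso M (S_mod n lambda rho) -> simple_mod M.
Proof.
move=> [f [g fK gK]]; have f_inj := can_inj fK.
(* The character sends [c%:A] to [c], so [f] is linear over [k] and quotients of its values are
   coordinates. *)
have scal (c : k) m : f (c%:A *: m) = c * f m :> k.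
  rewrite linearZ [LHS]/(S_eval rho _ * f m) S_evalZ S_eval1.
  by rewrite mulr1.
split.
  exists (g (1 : k)); apply/eqP => /(congr1 f); rewrite gK linear0.
  by move/eqP: (oner_neq0 k).
move=> U [U0 Ulin]; have [[m [Um m0]]|noU] := EM (exists m, m \in U /\ m != 0).
  (* A nonzero [m] in [U] spans everything: [c] is the ratio carrying [m] to [m']. *)
  right=> m'; rewrite inE; pose c : k := (f m' : k) / (f m : k).
  have fm0 : (f m : k) != 0.
    by apply: contra m0 => /eqP fm; apply/eqP/f_inj; rewrite linear0.
  have -> : m' = c%:A *: m + 0.
    by rewrite addr0; apply: f_inj; rewrite scal /c divfK.
  exact: Ulin.
left=> m; rewrite !inE; apply/idP/eqP => [Um|->] //.
by apply: contrapT => /eqP m0; apply: noU; exists m.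
Qed.

Lemma isotypic_submod (k : fieldType) (n : nat) (lambda : k)
    (M : lmodType (Q_alg k n lambda)) rho :
  (forall tau (m : M), a_ tau *: m = 0) -> submod_closed (isotypic M rho).
Proof.
move=> a0; apply: (scalar_submod (S_eval rho)) => [x m Mm||c u v].
- by apply: isotypic_act.
- by apply/forallP => t; rewrite !scaler0.
move=> /forallP Hu /forallP Hv; apply/forallP => t.
by apply/eqP; apply: act_eigen_lin; apply/eqP.
Qed.

Lemma isotypic_indecomposable_iso (k : fieldType) (n : nat) (lambda : k)
    (M : lmodType (Q_alg k n lambda)) rho d :
  (forall tau (m : M), a_ tau *: m = 0) -> isotypic M rho =i predT ->
  has_dim (isotypic M rho) d -> indecomposable M ->
  lmod_iso M (S_mod n lambda rho).
Proof.
move=> a0 Mrho [b [_ bP]] [Mn0 indec].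
have act x (m : M) : x *: m = (S_eval rho x)%:A *: m.
  by apply: isotypic_act => //; rewrite Mrho.
have [||m0 m0n0 m0P] := indecomposable_line (S_eval rho) d b act _ Mn0.
- by move=> m; apply: bP; rewrite Mrho.
- by move=> U V subU subV sUV UV0; apply: indec.
(* The coordinate along [m0] is chosen classically; [line_inj] makes it unique. *)
pose f (m : M) : S_mod n lambda rho := projT1 (cid (m0P m)).
have fE m : m = (f m : k)%:A *: m0 by rewrite /f; case: cid.
have f_lin : linear f by exact: line_coord_linear m0n0 act fE.
pose fL : {linear M -> S_mod n lambda rho} :=
  HB.pack f (GRing.isLinear.Build _ _ _ _ f f_lin).
exists fL; exists (fun c : k => c%:A *: m0) => [m|c]; first by rewrite -fE.
exact: line_inj m0n0 _ _ (esym (fE _)).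
Qed.

Arguments isotypic_indecomposable_iso {k n lambda M rho d}.

Theorem proposition3p13 (k : closedFieldType) (n : nat) (lambda : k)
  (M : lmodType (Q_alg k n lambda)) (p q : nat) :
  [pchar k] =i pred0 -> (4 <= n)%N ->
  is_direct_sum (isotypic M Eps) (isotypic M Sgn) ->
  has_dim (isotypic M Eps) p -> has_dim (isotypic M Sgn) q ->
  (indecomposable M <-> simple_mod M) /\
  (simple_mod M <-> lmod_iso M (S_mod n lambda Eps) \/
                    lmod_iso M (S_mod n lambda Sgn)).
Proof.
move=> k0 n4 Mdec dimE dimS.
have a0 tau (m : M) : a_ tau *: m = 0 by apply: a_act0.
have indec_iso : indecomposable M ->
    lmod_iso M (S_mod n lambda Eps) \/ lmod_iso M (S_mod n lambda Sgn).
  move=> indec; have [Msum _] := Mdec.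
  (* The isotypic decomposition is one into submodules, so one summand is zero and [M] is the
     other. *)
  have [E0|S0] := indec.2 _ _ (isotypic_submod _ _ _ _ _ a0) (isotypic_submod _ _ _ _ _ a0) Mdec.
    right.
    exact: isotypic_indecomposable_iso a0 (sum_pred0l _ _ _ Msum E0) dimS indec.
  left.
  exact: isotypic_indecomposable_iso a0 (sum_pred0r _ _ _ Msum S0) dimE indec.
have iso_simpleM : lmod_iso M (S_mod n lambda Eps) \/
    lmod_iso M (S_mod n lambda Sgn) -> simple_mod M.
  by case; apply: iso_simple.
have simple_indec := @simple_indecomposable k n lambda M.
(* The implications form a cycle: isomorphic to a character module, simple, indecomposable. *)
by split; split; auto.
Qed.
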